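(* Let $\mathcal H$ and $\mathcal G$ be real Hilbert spaces, let $z\in\mathcal H$, let $r\in\mathcal G$, let $f\colon\mathcal H\to\,]-\infty,+\infty]$ be proper, lower semicontinuous and convex, let $D$ be a nonempty closed convex subset of $\mathcal G$, and let $L\colon\mathcal H\to\mathcal G$ be a nonzero bounded linear operator such that $r\in\operatorname{sri}\big(L(\operatorname{dom}f)-\operatorname{bar}D\big)$. Let $x$ be the unique solution to the problem $$\underset{x\in\mathcal H}{\text{minimize}}\;\;f(x)+\sigma_D(Lx-r)+\tfrac12\|x-z\|^2,$$ and consider the dual problem $$\underset{v\in D}{\text{minimize}}\;\;\widetilde{f^*}(z-L^*v)+\langle v\mid r\rangle.\qquad (D')$$ Let $(a_n)_{n\in\mathbb N}$ be a sequence in $\mathcal G$ with $\sum_{n\in\mathbb N}\|a_n\|<+\infty$, let $(b_n)_{n\in\mathbb N}$ be a sequence in $\mathcal H$ with $\sum_{n\in\mathbb N}\|b_n\|<+\infty$, let $\varepsilon\in\,]0,\min\{1,\|L\|^{-2}\}[$, let $v_0\in\mathcal G$, let $(\gamma_n)_{n\in\mathbb N}$ be a sequence in $[\varepsilon,2\|L\|^{-2}-\varepsilon]$, let $(\lambda_n)_{n\in\mathbb N}$ be a sequence in $[\varepsilon,1]$, and define, for every $n\in\mathbb N$, $$x_n=\operatorname{prox}_f(z-L^*v_n)+b_n,\qquad v_{n+1}=v_n+\lambda_n\Big(P_D\big(v_n+\gamma_n(Lx_n-r)\big)+a_n-v_n\Big).$$ Then the following hold. (i) $(v_n)_{n\in\mathbb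 N}$ converges weakly to a solution $v$ to $(D')$, and $x=\operatorname{prox}_f(z-L^*v)$. (ii) $(x_n)_{n\in\mathbb N}$ converges strongly to $x$.
   Context: For a function $\varphi$ with values in $]-\infty,+\infty]$, $\operatorname{dom}\varphi=\{x : \varphi(x)<+\infty\}$. For a nonempty convex set $S$ in a Hilbert space, $\operatorname{cone}S=\bigcup_{\lambda>0}\{\lambda x: x\in S\}$, and the strong relative interior is $\operatorname{sri}S=\{x\in S:\operatorname{cone}(S-x)=\overline{\operatorname{span}}(S-x)\}$, where $\overline{\operatorname{span}}$ is the closed linear span. $\sigma_D(y)=\sup_{v\in D}\langle y\mid v\rangle$ is the support function of $D$, $\operatorname{bar}D=\{y\in\mathcal G:\sup_{v\in D}\langle y\mid v\rangle<+\infty\}$ is its barrier cone, and $P_D$ is the projector onto $D$. For $\varphi$ proper, lower semicontinuous and convex on a real Hilbert space: $\varphi^*(u)=\sup_x\langle x\mid u\rangle-\varphi(x)$ is its conjugate; $\widetilde{\varphi}(x)=\min_y\varphi(y)+\frac12\|x-y\|^2$ is its Moreau envelope (so $\widetilde{f^*}$ is the Moreau envelope of $f^*$); and $\operatorname{prox}_\varphi x$ is the unique minimizer of $y\mapsto\varphi(y)+\frac12\|x-y\|^2$. $L^*$ is the adjoint of $L$. *)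

(* Defs.v *)
From HB Require Import structures.
From mathcomp Require Import all_boot all_order all_algebra.
From mathcomp Require Import sesquilinear.
From mathcomp Require Import all_classical all_reals all_analysis.

Set Implicit Arguments.
Unset Strict Implicit.
Unset Printing Implicit Defensive.

Import Order.TTheory GRing.Theory Num.Theory.
Import numFieldNormedType.Exports.

Local Open Scope classical_set_scope.
Local Open Scope ring_scope.

HB.mixin Record CompleteNormedModule_isHilbert (R : realType) V
    & CompleteNormedModule R V := {
  inner : {dot V for @idfun R} ;
  inner_norm : forall x : V, inner x x = `|x| ^+ 2
}.

#[short(type="hilbertType")]
HB.structure Definition Hilbert (R : realType) :=
  {V of CompleteNormedModule R V & CompleteNormedModule_isHilbert R V}.

Notation "''[' x , y ]" := (inner x%R y%R) : ring_scope.

Section Hilbert.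
Context {R : realType}.
Implicit Types H G : hilbertType R.

Definition weak_cvg H (u : nat -> H) (l : H) : Prop :=
  forall w : H, '[u n, w] @[n --> \oo] --> '[l, w].

Definition bounded_operator H G (L : {linear H -> G}) : Prop :=
  exists M : R, forall x : H, `|L x| <= M * `|x|.

Definition opnorm H G (L : {linear H -> G}) : R :=
  sup [set `|L x| | x in [set x : H | `|x| <= 1]].

(* For bounded L the vector below exists and is unique (Riesz); the default 0
   is only reached when L is unbounded. *)
Definition adjoint H G (L : {linear H -> G}) (v : G) : H :=
  xget 0 [set u : H | forall x : H, '[L x, v] = '[x, u]].

Definition translate H (S : set H) (x : H) : set H := [set y - x | y in S].

Definition minkowski_sub H (A B : set H) : set H :=
  [set a - b | a in A & b in B].

Definition cone H (S : set H) : set H :=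
  [set y | exists2 l : R, 0 < l & exists2 x : H, S x & y = l *: x].

Definition linear_span H (S : set H) : set H :=
  [set y | exists n (c : 'I_n -> R) (s : 'I_n -> H),
     (forall i, S (s i)) /\ y = \sum_(i < n) c i *: s i].

Definition sri H (S : set H) : set H :=
  [set x | S x /\ cone (translate S x) = closure (linear_span (translate S x))].

Local Open Scope ereal_scope.

Definition dom H (f : H -> \bar R) : set H := [set x | f x < +oo].

Definition proper_efun H (f : H -> \bar R) : Prop :=
  (forall x, f x != -oo) /\ dom f !=set0.

(* Stated for t in the open interval, so that no product 0 * +oo occurs;
   meant for functions with values in ]-oo, +oo]. *)
Definition convex_efun H (f : H -> \bar R) : Prop :=
  forall (x y : H) (t : R), (0 < t < 1)%R ->
    f (t *: x + (1 - t) *: y)%R <= t%:E * f x + (1 - t)%:E * f y.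

Definition argmin H (A : set H) (F : H -> \bar R) : set H :=
  [set p | A p /\ forall q, A q -> F p <= F q].

Definition conjugate H (f : H -> \bar R) (u : H) : \bar R :=
  ereal_sup (range (fun x : H => '[x, u]%:E - f x)).

(* The infimum is attained when f is proper, lower semicontinuous and
   convex. *)
Definition moreau_envelope H (f : H -> \bar R) (x : H) : \bar R :=
  ereal_inf (range (fun y : H => f y + (2^-1 * `|x - y| ^+ 2)%:E)).

(* prox and projector take the unique minimizer, which exists for f proper, lower
   semicontinuous and convex, resp. D nonempty, closed and convex. *)
Definition prox H (f : H -> \bar R) (x : H) : H :=
  xget 0%R (argmin setT (fun y : H => f y + (2^-1 * `|x - y| ^+ 2)%:E)).

Definition projector H (D : set H) (x : H) : H :=
  xget 0%R (argmin D (fun y : H => `|x - y|%:E)).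

Definition support_fun H (D : set H) (y : H) : \bar R :=
  ereal_sup [set '[y, v]%:E | v in D].

Definition barrier_cone H (D : set H) : set H :=
  [set y | support_fun D y < +oo].

Definition summable_norm H (u : nat -> H) : Prop :=
  \sum_(0 <= n <oo) `|u n|%:E < +oo.

Definition primal_objective H G (f : H -> \bar R) (D : set G)
    (L : {linear H -> G}) (z : H) (r : G) (x : H) : \bar R :=
  f x + support_fun D (L x - r)%R + (2^-1 * `|x - z| ^+ 2)%:E.

Definition dual_objective H G (f : H -> \bar R)
    (L : {linear H -> G}) (z : H) (r : G) (v : G) : \bar R :=
  moreau_envelope (conjugate f) (z - adjoint L v)%R + '[v, r]%:E.

End Hilbert.

(* Main.v *)
(* Write p(v) = prox_f (z - L^* v). The Moreau envelope of f^* at y equals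
   <p | y> - f(p) - |p|^2/2 with p = prox_f y, so the dual objective is convex
   with gradient r - L p(v), which is cocoercive with constant |L|^-2, and its
   minimizers over D are the solutions of the variational inequality
   <L p(v) - r | w - v> <= 0 for w in D; each of them satisfies x = p(v).
   The qualification condition makes the lower level sets of the dual objective
   bounded modulo translations leaving the problem invariant (Banach-Steinhaus),
   hence a dual solution exists. The algorithm is an inexact forward-backward
   iteration: it is quasi-Fejer monotone with respect to the dual solutions, and
   the energy decrease forces p(v_n) -> x. Weak compactness is expressed by
   limits along ultrafilters: a bounded sequence has a weak limit along each of
   them by the Riesz theorem, and Opial's argument shows that all these limits
   coincide. *)
Require Import Defs.
From HB Require Import structures.
From mathcomp Require Import all_boot all_order all_algebra.
From mathcomp Require Import sesquilinear.
From mathcomp Require Import ring lra.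
From mathcomp Require Import all_classical all_reals all_analysis.

Set Implicit Arguments.
Unset Strict Implicit.
Unset Printing Implicit Defensive.

Import Order.TTheory GRing.Theory Num.Theory.
Import numFieldNormedType.Exports.

Local Open Scope classical_set_scope.
Local Open Scope ring_scope.

(** * Inner product identities and the Cauchy-Schwarz inequality *)

Section InnerProduct.
Context {R : realType} {H : hilbertType R}.
Implicit Types (u v w : H) (t : R).

Lemma innerC u v : '[u, v] = '[v, u].
Proof. by rewrite (hermC (@inner R H)) expr0 mul1r. Qed.

Lemma innerDl u v w : '[u + v, w] = '[u, w] + '[v, w].
Proof. exact: linearDl. Qed.

Lemma innerDr u v w : '[w, u + v] = '[w, u] + '[w, v].
Proof. exact: linearDr. Qed.

Lemma innerNl u v : '[- u, v] = - '[u, v].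
Proof. exact: linearNl. Qed.

Lemma innerNr u v : '[u, - v] = - '[u, v].
Proof. exact: linearNr. Qed.

Lemma innerBl u v w : '[u - v, w] = '[u, w] - '[v, w].
Proof. exact: linearBl. Qed.

Lemma innerBr u v w : '[w, u - v] = '[w, u] - '[w, v].
Proof. exact: linearBr. Qed.

Lemma innerZl t u v : '[t *: u, v] = t * '[u, v].
Proof. exact: linearZl_LR. Qed.

Lemma innerZr t u v : '[u, t *: v] = t * '[u, v].
Proof. exact: linearZr_LR. Qed.

Lemma inner0l v : '[0, v] = 0.
Proof. exact: linear0l. Qed.

Lemma inner0r v : '[v, 0] = 0.
Proof. exact: linear0r. Qed.

Definition innerE :=
  (innerDl, innerDr, innerBl, innerBr, innerNl, innerNr, innerZl, innerZr).

Lemma normr_sqD u v : `|u + v| ^+ 2 = `|u| ^+ 2 + 2 * '[u, v] + `|v| ^+ 2.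
Proof. by rewrite -!inner_norm !innerE (innerC v u); ring. Qed.

Lemma normr_sqB u v : `|u - v| ^+ 2 = `|u| ^+ 2 - 2 * '[u, v] + `|v| ^+ 2.
Proof. by rewrite -!inner_norm !innerE (innerC v u); ring. Qed.

(** The square of |v|^2 u - <u|v> v is nonnegative and expands to |v|^2 (|u|^2 |v|^2 - <u|v>^2). *)
Lemma normr_inner_le u v : `|'[u, v]| <= `|u| * `|v|.
Proof.
have [->|v0] := eqVneq v 0; first by rewrite inner0r !normr0 mulr0.
have nv : 0 < `|v| by rewrite normr_gt0.
have : 0 <= `| `|v| ^+ 2 *: u - '[u, v] *: v | ^+ 2 by rewrite sqr_ge0.
rewrite -inner_norm !innerE (innerC v u) !inner_norm.
rewrite [leRHS](_ : _ = `|v| ^+ 2 * ((`|u| * `|v|) ^+ 2 - '[u, v] ^+ 2)); last by ring.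
rewrite pmulr_rge0 ?exprn_gt0// subr_ge0 -(real_normK (num_real '[u, v])).
by rewrite ler_sqr// ?nnegrE ?mulr_ge0.
Qed.

Lemma inner_le u v : '[u, v] <= `|u| * `|v|.
Proof. exact: le_trans (ler_norm _) (normr_inner_le u v). Qed.

Lemma normr_sq_convex t u v :
  `|t *: u + (1 - t) *: v| ^+ 2 =
    t * `|u| ^+ 2 + (1 - t) * `|v| ^+ 2 - t * (1 - t) * `|u - v| ^+ 2.
Proof. by rewrite -!inner_norm !innerE (innerC v u); ring. Qed.

Lemma cvg_innerl (T : Type) (F : set_system T) (FF : Filter F) (u : T -> H) l w :
  u @ F --> l -> '[u t, w] @[t --> F] --> '[l, w].
Proof.
move=> ul; apply/cvgrPdist_le => e e0.
have w0 : 0 < `|w| + 1 by rewrite ltr_pwDr.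
move/cvgrPdist_le: ul => /(_ (e / (`|w| + 1)) (divr_gt0 e0 w0)).
apply: filterS => i hi; rewrite -innerBl (le_trans (normr_inner_le _ _))//.
rewrite (le_trans (ler_wpM2r _ hi))// -mulrA ger_pMr// mulrC ler_pdivrMr//.
by rewrite mul1r lerDl.
Qed.

End InnerProduct.

(** * Existence of proximal points *)

Section Prox.
Context {R : realType} {H : hilbertType R}.
Implicit Types (x y p q : H) (f : H -> \bar R).

Lemma convex_efun_le f y q (t a b : R) : convex_efun f -> 0 < t < 1 ->
  (f y <= a%:E)%E -> (f q <= b%:E)%E ->
  (f (t *: y + (1 - t) *: q)%R <= (t * a + (1 - t) * b)%:E)%E.
Proof.
move=> f_conv t01 fa fb; apply: le_trans (f_conv _ _ _ t01) _.
have /andP[t0 t1] := t01.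
by rewrite [leRHS]EFinD !EFinM leeD// lee_wpmul2l// lee_fin ?subr_ge0 ltW.
Qed.

(* Near [y0], lower semicontinuity keeps [f] above [f y0 - 1]; convexity along
   the segment from [y0] to [y] turns this into a linear lower bound. *)
Lemma convex_lsc_minorant f : proper_efun f -> lower_semicontinuous f ->
  convex_efun f ->
  exists y0 (c d : R), 0 <= d /\ forall y, ((c - d * `|y - y0|)%:E <= f y)%E.
Proof.
move=> [f_noo [y0 f_y0]] f_lsc f_conv.
have : f y0 \is a fin_num by rewrite fin_numE f_noo (lt_eqF f_y0).
move/fineK; set a0 := fine _ => fy0.
have : ((a0 - 1)%:E < f y0)%E by rewrite -fy0 lte_fin; lra.
move/f_lsc => [V /nbhs_ballP[e /= e0 ballV] fV].
exists y0, (a0 - 1), (2 / e); split; first by rewrite divr_ge0// ltW.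
move=> y; rewrite leNgt; apply/negP => fy.
have := fun h => fV _ (ballV y h); rewrite -ball_normE /= distrC.
have [ye|ye] := ltP `|y - y0| e.
  move=> /(_ isT) /lt_trans/(_ fy); rewrite lte_fin => a0lt.
  have : 0 <= 2 / e * `|y - y0| by rewrite mulr_ge0// divr_ge0// ltW.
  lra.
move=> _.
have n0 : 0 < `|y - y0| by exact: lt_le_trans ye.
(* This [t] puts [yt] at distance e/2 from [y0], inside the ball. With slope 2/e, the assumed bound
   on [f y] then gives f(yt) <= a0 - 1 - t, below the level a0 - 1. *)
pose t := e / (2 * `|y - y0|).
have t0 : 0 < t by rewrite divr_gt0// mulr_gt0.
have t1 : t < 1 by rewrite ltr_pdivrMr ?mulr_gt0//; lra.
have te : t * `|y - y0| = e / 2.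
  by rewrite /t; field; rewrite gt_eqF.
pose yt := t *: y + (1 - t) *: y0.
have yt0 : y0 - yt = t *: (y0 - y).
  by rewrite /yt scalerBr scalerBl scale1r opprD opprB addrCA subrKC addrC.
have /fV : V yt.
  apply: ballV; rewrite -ball_normE /= yt0 normrZ gtr0_norm// distrC te; lra.
have fy0' : (f y0 <= a0%:E)%E by rewrite fy0.
have t01 : 0 < t < 1 by rewrite t0.
have := convex_efun_le f_conv t01 (ltW fy) fy0'.
rewrite -/yt => /[swap] /lt_le_trans/[apply]; rewrite lte_fin.
rewrite (_ : t * _ = t * (a0 - 1) - 2 / e * (t * `|y - y0|)); last by ring.
rewrite te (_ : 2 / e * (e / 2) = 1); last by field; rewrite gt_eqF.
lra.
Qed.

Definition prox_objective f x y : \bar R := (f y + (2^-1 * `|x - y| ^+ 2)%:E)%E.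

(** The gain of 1/8 comes from [normr_sq_convex] at t = 1/2. This strong convexity makes minimizing
    sequences Cauchy. *)
Lemma prox_objective_midpoint f x y q (a b : R) : convex_efun f ->
  (prox_objective f x y <= a%:E)%E -> (prox_objective f x q <= b%:E)%E ->
  (prox_objective f x (2^-1 *: y + (1 - 2^-1) *: q)%R <=
     (2^-1 * (a + b) - 8^-1 * `|y - q| ^+ 2)%:E)%E.
Proof.
rewrite /prox_objective => f_conv fy fq.
have h01 : 0 < (2^-1 : R) < 1 by lra.
have {}fy : (f y <= (a - 2^-1 * `|x - y| ^+ 2)%:E)%E.
  by rewrite EFinB leeBrDr.
have {}fq : (f q <= (b - 2^-1 * `|x - q| ^+ 2)%:E)%E.
  by rewrite EFinB leeBrDr.
have := convex_efun_le f_conv h01 fy fq.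
rewrite -leeBrDr// -EFinB => /le_trans; apply; rewrite lee_fin.
have -> : x - (2^-1 *: y + (1 - 2^-1) *: q) = 2^-1 *: (x - y) + (1 - 2^-1) *: (x - q).
  rewrite !scalerBr addrACA -scalerDl opprD; congr (_ + _).
  by rewrite addrC subrK scale1r.
rewrite normr_sq_convex (_ : x - y - (x - q) = - (y - q)); last first.
  by rewrite opprB addrC subrKA opprB.
rewrite normrN; lra.
Qed.

(** The quadratic term absorbs the linear decay of the minorant, since h^2/2 - d h >= - d^2/2. *)
Lemma prox_objective_lbound f x : proper_efun f -> lower_semicontinuous f ->
  convex_efun f -> exists c : R, forall y, (c%:E <= prox_objective f x y)%E.
Proof.
move=> f_prop f_lsc f_conv.
have [y0 [c [d [d0 fcd]]]] := convex_lsc_minorant f_prop f_lsc f_conv.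
exists (c - d * `|x - y0| - 2^-1 * d ^+ 2) => y.
apply: (@le_trans _ _ ((c - d * `|y - y0|)%:E + (2^-1 * `|x - y| ^+ 2)%:E)%E).
  rewrite -EFinD lee_fin.
  have := ler_wpM2l d0 (ler_distD x y y0); rewrite (distrC y x).
  have := sqr_ge0 (`|x - y| - d); rewrite sqrrB; lra.
by rewrite /prox_objective leeD2r.
Qed.

Lemma prox_exists f x : proper_efun f -> lower_semicontinuous f ->
  convex_efun f -> argmin setT (prox_objective f x) !=set0.
Proof.
move=> f_prop f_lsc f_conv.
(* Real upper bounds replace the values, which may be +oo, so that the infimum is taken in [R]. *)
pose E := [set a : R | exists y, (prox_objective f x y <= a%:E)%E].
have [c cF] := prox_objective_lbound x f_prop f_lsc f_conv.
have E_inf : has_inf E.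
  split.
    have [f_noo [y0 f_y0]] := f_prop.
    have : prox_objective f x y0 \is a fin_num.
      by rewrite fin_numD /= andbT fin_numE f_noo (lt_eqF f_y0).
    by move=> /fineK fE; exists (fine (prox_objective f x y0)), y0; rewrite fE.
  by exists c => a [y Fy]; rewrite -lee_fin (le_trans (cF y)).
pose m := inf E.
have mE a : E a -> m <= a by apply: ge_inf; case: E_inf.
have h n : exists y, (prox_objective f x y <= (m + n.+1%:R^-1)%:E)%E.
  have /inf_adherent/(_ E_inf)[a [y ya] /ltW am] : 0 < n.+1%:R^-1 :> R by [].
  by exists y; rewrite (le_trans ya)// lee_fin.
have {h}[y_ y_min] := choice h.
have y_dist n k : `|y_ n - y_ k| ^+ 2 <= 4 * (n.+1%:R^-1 + k.+1%:R^-1).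
  have := prox_objective_midpoint f_conv (y_min n) (y_min k).
  move=> Fnk.
  have /mE : E (2^-1 * (m + n.+1%:R^-1 + (m + k.+1%:R^-1)) -
                  8^-1 * `|y_ n - y_ k| ^+ 2) by eexists; exact: Fnk.
  by move: (n.+1%:R^-1) (k.+1%:R^-1) (`|_ - _| ^+ 2) => A B d; lra.
have : cauchy (y_ n @[n --> \oo]).
  apply: cauchy_exP => e e0 /=.
  have e8 : 0 < e ^+ 2 / 16 by rewrite divr_gt0// exprn_gt0.
  have [N _ hN] := near_infty_natSinv_lt (PosNum e8).
  exists (y_ N); exists N => // n /= Nn; rewrite -ball_normE /=.
  rewrite -ltr_sqr ?nnegrE// ?(ltW e0)// (le_lt_trans (y_dist _ _))//.
  have := hN _ Nn; have := hN _ (leqnn N) => /=.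
  by move: (N.+1%:R^-1) (n.+1%:R^-1) (e ^+ 2) {hN}e8 => A B d; lra.
move/cauchy_cvg => /cvg_ex[/= p yp].
exists p; split => // q _.
have mq : (m%:E <= prox_objective f x q)%E.
  have := cF q; case Fq: (prox_objective f x q) => [s| |]; rewrite ?leey//.
  by rewrite !lee_fin => _; apply: mE; exists q; rewrite Fq.
apply: le_trans mq; rewrite leNgt; apply/negP => mp.
(* Lower semicontinuity is tested at real levels, and [f p] may be +oo, so a real [a] is
   interposed. *)
have [a [ma afp]] : exists a, m - 2^-1 * `|x - p| ^+ 2 < a /\ (a%:E < f p)%E.
  move: mp; rewrite -lteBlDr// -EFinB; set b := m - _.
  case: (f p) => [s| |]//; rewrite ?lte_fin => bs.
    by exists (2^-1 * (b + s)); rewrite lte_fin; lra.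
  by exists (b + 1); rewrite ltry; split=> //; lra.
have [V Vp fV] := f_lsc _ _ afp.
pose e := a - (m - 2^-1 * `|x - p| ^+ 2).
have e2 : 0 < e / 2 by rewrite divr_gt0// subr_gt0.
have y_sq : 2^-1 * `|x - y_ n| ^+ 2 @[n --> \oo] --> 2^-1 * `|x - p| ^+ 2.
  by apply: cvgMr; rewrite expr2; under eq_fun do rewrite expr2;
     apply: cvgM; apply: cvg_norm; apply: cvgB => //; exact: cvg_cst.
have [n [Vn hn ne]] : exists n, [/\ V (y_ n),
    2^-1 * `|x - p| ^+ 2 - e / 2 < 2^-1 * `|x - y_ n| ^+ 2 & n.+1%:R^-1 < e / 2].
  have : \forall n \near \oo, [/\ V (y_ n),
    2^-1 * `|x - p| ^+ 2 - e / 2 < 2^-1 * `|x - y_ n| ^+ 2 & n.+1%:R^-1 < e / 2].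
    near=> n; split.
    - by near: n; exact: yp.
    - near: n; move/cvgrPdist_lt: y_sq => /(_ _ e2); apply: filterS => n.
      by rewrite ltr_norml => /andP[_]; lra.
    - by near: n; exact: (near_infty_natSinv_lt (PosNum e2)).
  by move=> [N _ /(_ N (leqnn N))]; exists N.
have := lt_le_trans (fV _ Vn) _.
move: (y_min n); rewrite /prox_objective -leeBrDr// -EFinB.
move=> /[swap] /[apply]; rewrite lte_fin /e in hn ne *.
by move: (n.+1%:R^-1) (`|x - p| ^+ 2) (`|x - y_ n| ^+ 2) hn ne => A B d; lra.
Unshelve. all: by end_near.
Qed.

End Prox.

(** Replaces the passage t -> 0 in first-order conditions. If c > 0, the choice t = c / (2 (c +
    |K|)) gives t K < c. *)
Lemma le0_of_le_scaled {R : realFieldType} (c K : R) :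
  (forall t, 0 < t < 1 -> c <= t * K) -> c <= 0.
Proof.
move=> h; rewrite leNgt; apply/negP => c0.
have d0 : 0 < 2 * (c + `|K|) by have := normr_ge0 K; lra.
have := h (c / (2 * (c + `|K|))).
rewrite divr_gt0// ltr_pdivrMr// mul1r; have K0 := normr_ge0 K.
have cK : c < 2 * (c + `|K|) by lra.
move=> /(_ cK); apply/negP; rewrite -ltNge mulrAC ltr_pdivrMr//.
by rewrite ltr_pM2l//; have := ler_norm K; lra.
Qed.

(** * The variational inequality of the proximal point *)

Section ProxInequality.
Context {R : realType} {H : hilbertType R}.
Context (f : H -> \bar R).
Hypotheses (f_proper : proper_efun f) (f_lsc : lower_semicontinuous f).
Hypothesis f_convex : convex_efun f.
Implicit Types x y q : H.

Lemma prox_argmin x : argmin setT (prox_objective f x) (prox f x).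
Proof. by apply: xgetPex; exact: prox_exists. Qed.

Lemma prox_fin_num x : f (prox f x) \is a fin_num.
Proof.
have [f_noo [y0 f_y0]] := f_proper; have [_ /(_ y0 I)] := prox_argmin x.
rewrite fin_numE f_noo /= /prox_objective; apply: contraTneq => ->.
by rewrite addye// -ltNge; apply: lte_add_pinfty; rewrite ?ltry.
Qed.

(** Minimality at p = prox_f x is tested at t q + (1 - t) p; after division by t, the remainder t |q
    - p|^2 / 2 vanishes with t. In other words, x - p is a subgradient of [f] at p. *)
Lemma prox_ineq x q :
  (f (prox f x) + '[x - prox f x, q - prox f x]%:E <= f q)%E.
Proof.
have [_ p_min] := prox_argmin x; set p := prox f x in p_min *.
have /fineK := prox_fin_num x; rewrite -/p; set a := fine _ => fp.
rewrite -fp -EFinD.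
have [f_noo _] := f_proper; have := f_noo q.
case fq: (f q) => [s| |]// _; last by rewrite leey.
rewrite lee_fin -subr_le0; apply: (@le0_of_le_scaled _ _ (2^-1 * `|q - p| ^+ 2)).
move=> t t01; have /andP[t0 t1] := t01.
have fq' : (f q <= s%:E)%E by rewrite fq.
have fp' : (f p <= a%:E)%E by rewrite -fp.
have fpt := convex_efun_le f_convex t01 fq' fp'.
have := le_trans (p_min _ I) (leeD2r _ fpt).
rewrite /prox_objective -/p -fp -!EFinD lee_fin.
have -> : x - (t *: q + (1 - t) *: p) = (x - p) - t *: (q - p).
  rewrite -addrA; congr (_ + _); rewrite scalerBl scale1r scalerBr !opprD !opprK.
  by rewrite addrCA.
rewrite (normr_sqB (x - p)) innerZr normrZ exprMn (gtr0_norm t0) => h.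
rewrite -(ler_pM2l t0); nra.
Qed.

End ProxInequality.

(** * Projection onto a closed convex set *)

Section Projector.
Context {R : realType} {G : hilbertType R} (D : set G).
Hypotheses (D_neq0 : D !=set0) (D_closed : closed D).
Hypothesis D_convex : convex_set (D : set (convex_lmodType G)).

(** The projection is the proximal point of this indicator function, so existence and the
    variational inequality are inherited from [prox]. *)
Let ind (y : G) : \bar R := if y \in D then 0%E else +oo%E.

Lemma convex_setP (x y : G) (t : R) : D x -> D y -> 0 < t < 1 ->
  D (t *: x + (1 - t) *: y).
Proof.
move=> Dx Dy /andP[t0 t1].
have := D_convex (Itv01 (ltW t0) (ltW t1)) (mem_set Dx) (mem_set Dy).
by move=> /set_mem.
Qed.

Let ind_proper : proper_efun ind.
Proof.
split=> [x|]; first by rewrite /ind; case: ifP.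
by case: D_neq0 => x Dx; exists x; rewrite /dom /= /ind (mem_set Dx) ltry.
Qed.

Let ind_lsc : lower_semicontinuous ind.
Proof.
move=> x a; rewrite /ind; case: ifPn => [_|/negP xD _].
  move=> a0; exists setT; first exact: filterT.
  by move=> y _; case: ifP => // _; rewrite ltry.
exists (~` D).
  by apply: open_nbhs_nbhs; split; [exact/closed_openC|move=> /mem_set].
by move=> y; case: ifPn => [/set_mem|_ _]//; rewrite ltry.
Qed.

Let ind_convex : convex_efun ind.
Proof.
move=> x y t t01; have /andP[t0 t1] := t01; rewrite /ind.
case: (boolP (x \in D)) => [/set_mem Dx|_]; last first.
  rewrite gt0_muley ?lte_fin// addye ?leey//; case: ifP; rewrite ?mule0//.
  by rewrite gt0_muley ?lte_fin ?subr_gt0.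
case: (boolP (y \in D)) => [/set_mem Dy|_].
  by rewrite (mem_set (convex_setP Dx Dy t01)) !mule0 adde0.
by rewrite [X in (_ + X)%E]gt0_muley ?lte_fin ?subr_gt0// mule0 addey ?leey.
Qed.

Lemma projectorP x :
  D (projector D x) /\
  forall w, D w -> '[x - projector D x, w - projector D x] <= 0.
Proof.
set p := prox ind x.
have Dp : D p.
  have := prox_fin_num ind_proper ind_lsc ind_convex x.
  by rewrite /ind -/p; case: ifPn => // /set_mem.
have p_ineq w : D w -> '[x - p, w - p] <= 0.
  move=> Dw; have := prox_ineq ind_proper ind_lsc ind_convex x w.
  by rewrite -/p /ind !mem_set// add0e lee_fin.
(* [projector] minimizes the distance and not its half square, so the point it selects is not [p] by
   definition. The gap |w - p|^2 forces them to agree. *)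
have p_gap w : D w -> `|x - p| ^+ 2 + `|w - p| ^+ 2 <= `|x - w| ^+ 2.
  move=> /p_ineq; rewrite -[x - w](subrKA p) -(opprB w p) (normr_sqB (x - p)).
  lra.
have : argmin D (fun y : G => `|x - y|%:E) (projector D x).
  apply: xgetPex; exists p; split=> // w /p_gap pw; rewrite lee_fin.
  by rewrite -ler_sqr ?nnegrE//; have := sqr_ge0 `|w - p|; lra.
move=> [DP /(_ p Dp)]; rewrite lee_fin -ler_sqr ?nnegrE// => le_p.
have /p_gap := DP; have := sqr_ge0 `|projector D x - p| => ge0 le_x.
have /eqP : `|projector D x - p| ^+ 2 = 0 by lra.
by rewrite sqrf_eq0 normr_eq0 subr_eq0 => /eqP ->.
Qed.

Lemma projector_nonexpansive x y :
  `|projector D x - projector D y| <= `|x - y|.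
Proof.
have [Dp /(_ (projector D y))] := projectorP x.
have [Dq /(_ (projector D x) Dp) + /(_ Dq)] := projectorP y.
set p := projector D x; set q := projector D y => hq hp.
have [->|pq0] := eqVneq (p - q) 0; first by rewrite normr0.
have npq : 0 < `|p - q| by rewrite normr_gt0.
rewrite -(ler_pM2l npq) -expr2; apply: le_trans (inner_le _ _).
rewrite -inner_norm; move: hq hp; rewrite -(opprB p q) !innerE.
by rewrite ?(innerC x) ?(innerC y) (innerC q p); lra.
Qed.

End Projector.

(** * The Riesz representation theorem *)

Section Riesz.
Context {R : realType} {H : hilbertType R}.

(** The representing vector p minimizes |x|^2/2 - phi(x), so it is the proximal point of - phi at 0.
    Its inequality tested at p + v and p - v gives both bounds on phi v. *)
Lemma riesz (phi : H -> R) (M : R) :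
  (forall (t : R) (u v : H), phi (t *: u + v) = t * phi u + phi v) ->
  (forall u, `|phi u| <= M * `|u|) ->
  exists u, forall v, phi v = '[v, u].
Proof.
move=> phi_lin phi_bnd.
have phiD u v : phi (u + v) = phi u + phi v by rewrite -{1}[u]scale1r phi_lin mul1r.
have phi0 : phi 0 = 0.
  by apply: (@addrI _ (phi 0)); rewrite -phiD !addr0.
have phiZ t u : phi (t *: u) = t * phi u by rewrite -[_ *: _]addr0 phi_lin phi0 addr0.
have phiN u : phi (- u) = - phi u by rewrite -scaleN1r phiZ mulN1r.
pose g := fun x : H => (- phi x)%:E.
have g_proper : proper_efun g.
  by split=> [x|]; [|exists 0; rewrite /dom /= ltry].
have g_lsc : lower_semicontinuous g.
  move=> x a; rewrite lte_fin => ax.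
  have M0 : 0 < `|M| + 1 by rewrite ltr_pwDr.
  have e0 : 0 < (- phi x - a) / (`|M| + 1) by rewrite divr_gt0// subr_gt0.
  exists (ball x ((- phi x - a) / (`|M| + 1))); first exact: nbhsx_ballx.
  move=> y; rewrite -ball_normE /= ltr_pdivlMr// => xy; rewrite lte_fin.
  have := phi_bnd (y - x); rewrite phiD phiN (distrC y x) ler_norml => /andP[_].
  have := ler_wpM2r (normr_ge0 (x - y)) (ler_norm M).
  have := normr_ge0 (x - y); lra.
have g_convex : convex_efun g.
  move=> u v t t01; rewrite /g -!EFinM -EFinD lee_fin phiD !phiZ; lra.
exists (prox g 0) => v; set p := prox g 0.
have := prox_ineq g_proper g_lsc g_convex 0 (p + v).
have := prox_ineq g_proper g_lsc g_convex 0 (p - v).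
rewrite -/p /g -!EFinD !lee_fin !phiD phiN sub0r addrAC subrr add0r.
rewrite [p + v]addrC addrK !innerE (innerC v p); lra.
Qed.

End Riesz.

(** * Limits along ultrafilters and weak compactness *)

Section UltraLimits.
Context {R : realType}.

(** Compactness of [-M, M] supplies a cluster point, and it is a limit because an ultrafilter
    contains every set or its complement. *)
Lemma ultra_bounded_cvg (T : Type) (U : set_system T) (u : T -> R) (M : R) :
  UltraFilter U -> (forall t, `|u t| <= M) -> exists l : R, u @ U --> l.
Proof.
move=> UU uM.
have [l [_ l_cluster]] : `[- M, M]%classic `&` cluster (u @ U) !=set0.
  apply: (segment_compact (a := - M) (b := M)).
  by apply: (@filterE _ U) => t; have := uM t; rewrite /= in_itv /= ler_norml.
exists l => A lA; have [//|UC] := in_ultra_setVsetC (u @^-1` A) UU.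
by have [y []] := l_cluster (~` A) A UC lA.
Qed.

(** If the preimage of a neighborhood of [l] were not in [F], then [F] restricted to its complement
    would extend to an ultrafilter along which [u] avoids that neighborhood. *)
Lemma cvg_ultra (T : Type) (V : topologicalType) (F : set_system T)
    (FF : Filter F) (u : T -> V) (l : V) :
  (forall U, UltraFilter U -> F `<=` U -> u @ U --> l) -> u @ F --> l.
Proof.
move=> ultra_l A lA; apply: contrapT => nFA.
have WP : ProperFilter (within (~` (u @^-1` A)) F).
  split; last exact: within_filter.
  move=> FA; apply: nFA; move: FA; rewrite /within /=.
  by apply: filterS => t h; apply: contrapT => /h.
have [U [UU WU]] := ultraFilterLemma WP.
have FU : F `<=` U by move=> B FB; apply: WU; rewrite /within /=; apply: filterS FB.
have UA : U (u @^-1` A) by apply: (ultra_l U UU FU) lA.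
have UC : U (~` (u @^-1` A)) by apply: WU; exact: withinT.
have [t [] //] := filter_ex (filterI UA UC).
Qed.

Context {H : hilbertType R}.

(** The scalar limits of <u t|w> form a bounded linear functional of [w], which [riesz]
    represents. *)
Lemma weak_ultralimit (T : Type) (U : set_system T) (u : T -> H) (M : R) :
  UltraFilter U -> (forall t, `|u t| <= M) ->
  exists l, forall w, '[u t, w] @[t --> U] --> '[l, w].
Proof.
move=> UU uM.
have uwM w t : `|'[u t, w]| <= M * `|w|.
  by rewrite (le_trans (normr_inner_le _ _))// ler_wpM2r.
have [phi phiP] := choice (fun w => ultra_bounded_cvg UU (uwM w)).
have phi_lin (c : R) (v w : H) : phi (c *: v + w) = c * phi v + phi w.
  have := phiP (c *: v + w).
  under eq_fun do rewrite innerDr innerZr.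
  move/cvg_unique; apply => //.
  by apply: cvgD; [apply: cvgMr|]; exact: phiP.
have phi_bnd w : `|phi w| <= M * `|w|.
  have phi_cvg : `|'[u t, w]| @[t --> U] --> `|phi w|.
    exact: cvg_norm (phiP w).
  by apply: (cvgr_to_le phi_cvg); apply: filterE => t; exact: uwM.
have [l lP] := riesz phi_lin phi_bnd.
by exists l => w; rewrite innerC -lP; exact: phiP.
Qed.

(** Splits <u t|v t> into <u t - l|v t> + <v t|l>; the first term vanishes because [v] is bounded,
    and the second is a weak limit. *)
Lemma cvg_inner_weak (T : Type) (F : set_system T) (FF : Filter F)
    (u v : T -> H) (l m : H) (M : R) : (forall t, `|v t| <= M) ->
  u @ F --> l -> (forall w, '[v t, w] @[t --> F] --> '[m, w]) ->
  '[u t, v t] @[t --> F] --> '[l, m].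
Proof.
move=> vM ul vm.
have -> : (fun t => '[u t, v t]) = (fun t => '[u t - l, v t] + '[v t, l]).
  by apply/funext => t; rewrite innerBl (innerC (v t) l) subrK.
rewrite -['[l, m]]add0r (innerC l m); apply: cvgD; last exact: vm.
have ul0 : `|u t - l| * M @[t --> F] --> 0.
  rewrite -[0](mul0r M); apply: cvgMl.
  rewrite -[0](normr0 H) -(subrr l); apply: cvg_norm; apply: cvgB => //.
  exact: cvg_cst.
apply/norm_cvg0P; apply: (squeeze_cvgr _ (cvg_cst 0) ul0).
apply: filterE => t; rewrite normr_ge0 /= (le_trans (normr_inner_le _ _))//.
by rewrite ler_wpM2l.
Qed.

End UltraLimits.

(** * Operator norm and adjoint *)

Section Operators.
Context {R : realType} {H G : hilbertType R} (L : {linear H -> G}).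
Hypothesis L_bounded : bounded_operator L.

Lemma inner_ext (u v : H) : (forall w, '[w, u] = '[w, v]) -> u = v.
Proof.
move=> uv; apply/eqP; rewrite -subr_eq0 -normr_eq0 -sqrf_eq0 -inner_norm.
by rewrite innerBr uv subrr.
Qed.

Lemma opnorm_ub x : `|x| <= 1 -> `|L x| <= opnorm L.
Proof.
move=> x1; apply: sup_ubound; last by exists x.
have [M LM] := L_bounded.
exists `|M| => _ [y y1 <-]; rewrite (le_trans (LM y))//.
rewrite (le_trans (ler_wpM2r (normr_ge0 _) (ler_norm M)))//.
by rewrite ler_piMr.
Qed.

Lemma opnorm_le x : `|L x| <= opnorm L * `|x|.
Proof.
have [->|x0] := eqVneq x 0; first by rewrite linear0 !normr0 mulr0.
have nx : 0 < `|x| by rewrite normr_gt0.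
have := @opnorm_ub (`|x|^-1 *: x); rewrite linearZ !normrZ normfV normr_id.
by rewrite mulVf ?gt_eqF// mulrC ler_pdivrMr//; apply.
Qed.

Lemma opnorm_gt0 : (exists u, L u != 0) -> 0 < opnorm L.
Proof.
move=> [u Lu0]; have := opnorm_le u; have := normr_gt0 (L u); rewrite Lu0.
move=> /lt_le_trans/[apply]; apply: contraTT; rewrite -!leNgt => l0.
by rewrite mulr_le0_ge0.
Qed.

(** [riesz] shows that the set from which [adjoint] chooses is nonempty. *)
Lemma adjointP x v : '[L x, v] = '[x, adjoint L v].
Proof.
suff : [set u : H | forall x, '[L x, v] = '[x, u]] (adjoint L v) by apply.
apply: xgetPex; apply: (@riesz _ _ _ (opnorm L * `|v|)).
  by move=> t y w; rewrite linearP innerDl innerZl.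
move=> y; rewrite (le_trans (normr_inner_le _ _))// mulrAC ler_wpM2r//.
exact: opnorm_le.
Qed.

Lemma adjointB v w : adjoint L (v - w) = adjoint L v - adjoint L w.
Proof. by apply: inner_ext => x; rewrite innerBr -!adjointP innerBr. Qed.

End Operators.

(** * Firm nonexpansiveness of [prox] and the Moreau envelope of the conjugate *)

Section MoreauConjugate.
Context {R : realType} {H : hilbertType R} (f : H -> \bar R).
Hypotheses (f_proper : proper_efun f) (f_lsc : lower_semicontinuous f).
Hypothesis f_convex : convex_efun f.

(** Adding [prox_ineq] at [x] and at [y], each tested at the other proximal point, cancels the
    values of [f]. *)
Lemma prox_firm x y :
  `|prox f x - prox f y| ^+ 2 <= '[prox f x - prox f y, x - y].
Proof.
have := prox_ineq f_proper f_lsc f_convex x (prox f y).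
have := prox_ineq f_proper f_lsc f_convex y (prox f x).
rewrite -(fineK (prox_fin_num f_proper f_lsc f_convex x)).
rewrite -(fineK (prox_fin_num f_proper f_lsc f_convex y)) -!EFinD !lee_fin.
move: (prox f x) (prox f y) => p q; rewrite -inner_norm.
rewrite !innerE ?(innerC x) ?(innerC y) (innerC q p); lra.
Qed.

(* Equivalently, the value at [y] of the conjugate of f + |.|^2/2. *)
Definition conj_env (y : H) : R :=
  '[prox f y, y] - fine (f (prox f y)) - 2^-1 * `|prox f y| ^+ 2.

(** For the upper bound the infimum is tested at y - p, where [prox_ineq] bounds the conjugate. The
    lower bound is the Fenchel-Young inequality at p together with |p - (y - u)|^2 >= 0. *)
Lemma moreau_envelope_conjugateE y :
  moreau_envelope (conjugate f) y = (conj_env y)%:E.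
Proof.
set p := prox f y; have /fineK := prox_fin_num f_proper f_lsc f_convex y.
rewrite -/p; set a := fine _ => fp.
have [f_noo _] := f_proper.
apply/eqP; rewrite eq_le; apply/andP; split.
  apply: (@le_trans _ _ (conjugate f (y - p)%R + (2^-1 * `|y - (y - p)| ^+ 2)%:E)%E).
    by apply: ereal_inf_lbound; exists (y - p).
  have conj_le : (conjugate f (y - p)%R <= ('[p, y - p] - a)%:E)%E.
    apply: ge_ereal_sup => _ [x _ <-].
    have := prox_ineq f_proper f_lsc f_convex y x; have := f_noo x.
    rewrite -/p -fp -EFinD; case: (f x) => [s| |]//=; last by rewrite addeNy leNye.
    by rewrite -EFinB !lee_fin !innerE ?(innerC y) (innerC x p); lra.
  rewrite (le_trans (leeD2r _ conj_le))// -EFinD lee_fin opprB subrKC.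
  by rewrite /conj_env -/p -/a -inner_norm !innerE; lra.
apply: le_ereal_inf_tmp => _ [u _ <-].
have conj_ge : (('[p, u] - a)%:E <= conjugate f u)%E.
  by apply: ereal_sup_ubound; exists p => //; rewrite -fp EFinB.
apply: le_trans (leeD2r _ conj_ge); rewrite -EFinD lee_fin /conj_env -/p -/a.
have := sqr_ge0 `|p - (y - u)|; rewrite (normr_sqB p) innerBr; lra.
Qed.

(** The proximal point maximizes <x|y> - f(x) - |x|^2/2 over x. Each x in the domain thus gives an
    affine minorant in [y]. *)
Lemma conj_env_ge (x y : H) (s : R) : f x = s%:E ->
  '[x, y] - s - 2^-1 * `|x| ^+ 2 <= conj_env y.
Proof.
move=> fx; have := prox_ineq f_proper f_lsc f_convex y x.
rewrite -(fineK (prox_fin_num f_proper f_lsc f_convex _)) fx -EFinD lee_fin.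
rewrite /conj_env; set p := prox f y; have := sqr_ge0 `|x - p|.
by rewrite normr_sqB -!inner_norm !innerE ?(innerC y) (innerC p x); lra.
Qed.

End MoreauConjugate.

(** * Closed subspaces, weak closedness, uniform boundedness, barrier cones *)

Section ClosedSubspace.
Context {R : realType} {G : hilbertType R}.
Implicit Types (S V D : set G) (y w : G).

Definition is_subspace V := V 0 /\ forall (t : R) y w, V y -> V w -> V (t *: y + w).

Lemma subspaceN V y : is_subspace V -> V y -> V (- y).
Proof. by move=> [V0 VP] Vy; rewrite -scaleN1r -[_ *: _]addr0; exact: VP. Qed.

Lemma linear_span_subspace S : is_subspace (linear_span S).
Proof.
split; first by exists 0%N, (fun=> 0), (fun=> 0); rewrite big_ord0; split=> // -[].
move=> t _ _ [m [c [s [sS ->]]]] [n [d [u [uS ->]]]].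
pose e (T : Type) (g : 'I_m -> T) (h : 'I_n -> T) i :=
  match fintype.split i with inl j => g j | inr k => h k end.
exists (m + n)%N, (e R (fun i => t * c i) d), (e G s u); split.
  by move=> i; rewrite /e; case: (fintype.split i).
rewrite big_split_ord scaler_sumr; congr (_ + _); apply: eq_bigr => i _.
  by rewrite /e -[lshift n i]/(unsplit (inl i)) unsplitK scalerA.
by rewrite /e -[rshift m i]/(unsplit (inr i)) unsplitK.
Qed.

Lemma closure_normP S y :
  closure S y <-> forall e : R, 0 < e -> exists2 w, S w & `|y - w| < e.
Proof.
split=> [Sy e e0|Sy B /nbhs_ballP[e /= e0 eB]].
  by have [w [Sw]] := Sy _ (nbhsx_ballx y e e0); rewrite -ball_normE; exists w.
by have [w Sw yw] := Sy e e0; exists w; split=> //; apply: eB; rewrite -ball_normE.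
Qed.

Lemma closure_subspace S : is_subspace S -> is_subspace (closure S).
Proof.
move=> [S0 SP]; split; first exact: subset_closure.
move=> t y w /closure_normP Sy /closure_normP Sw; apply/closure_normP => e e0.
have t0 : 0 < 2 * (`|t| + 1) by have := normr_ge0 t; lra.
have [y' Sy' yy'] := Sy _ (divr_gt0 e0 t0).
have e2 : 0 < e / 2 by lra.
have [w' Sw' ww'] := Sw _ e2.
exists (t *: y' + w'); first exact: SP.
rewrite opprD addrACA -scalerBr (le_lt_trans (ler_normD _ _))// normrZ.
rewrite [ltRHS](splitr e) ler_ltD//.
rewrite (le_trans (ler_wpM2l _ (ltW yy')))// mulrA ler_pdivrMr//.
rewrite (_ : e / 2 * _ = (`|t| + 1) * e); last by field.
by apply: ler_wpM2r; [exact: ltW|rewrite lerDl].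
Qed.

Lemma subspace_convex V :
  is_subspace V -> convex_set (V : set (convex_lmodType G)).
Proof.
move=> V_sub y w t /set_mem Vy /set_mem Vw; apply/mem_set.
have [V0 VP] := V_sub; apply: (VP t%:num) => //.
by rewrite -[_ *: w]addr0; exact: VP.
Qed.

(** The variational inequality of the projection p is tested at p + w and p - w. *)
Lemma projector_orthogonal V y w : is_subspace V -> closed V -> V w ->
  '[y - projector V y, w] = 0.
Proof.
move=> V_sub V_closed Vw.
have V_neq0 : V !=set0 by exists 0; case: V_sub.
have [Vp p_le] := projectorP V_neq0 V_closed (subspace_convex V_sub) y.
set p := projector V y in Vp p_le *.
have [_ VP] := V_sub.
have := p_le _ (VP 1 _ _ Vw Vp); have := p_le _ (VP (-1) _ _ Vw Vp).
rewrite !addrK !innerZr; lra.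
Qed.

(** With p the projection of [l], each u t in [D] satisfies <u t - p|l - p> <= 0; the weak limit of
    this inequality is |l - p|^2 <= 0. *)
Lemma convex_weak_closed D (T : Type) (F : set_system T) (FF : ProperFilter F)
    (u : T -> G) (l : G) :
  closed D -> convex_set (D : set (convex_lmodType G)) ->
  (\forall t \near F, D (u t)) ->
  (forall w, '[u t, w] @[t --> F] --> '[l, w]) -> D l.
Proof.
move=> D_closed D_convex Du ul.
have D_neq0 : D !=set0 by have [t] := filter_ex Du; exists (u t).
have [Dp p_le] := projectorP D_neq0 D_closed D_convex l.
set p := projector D l in Dp p_le.
suff <- : p = l by [].
have up : '[u t, l - p] - '[p, l - p] @[t --> F] --> '[l, l - p] - '[p, l - p].
  by apply: cvgB => //; exact: cvg_cst.
have := cvgr_to_le (b := 0) up; rewrite -innerBl inner_norm => h.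
have {}h : `|l - p| ^+ 2 <= 0.
  by apply: h; apply: filterS Du => t Dt; rewrite -innerBl innerC; exact: p_le.
apply/esym/eqP; rewrite -subr_eq0 -normr_eq0 -sqrf_eq0.
by rewrite eq_le h sqr_ge0.
Qed.

(** Banach-Steinhaus is applied to the functionals <v|.>, and |v| is recovered by evaluating at v /
    |v|. *)
Lemma weakly_bounded_bounded (A : set G) :
  (forall y, exists C : R, forall v, A v -> `|'[v, y]| <= C) ->
  exists C : R, forall v, A v -> `|v| <= C.
Proof.
move=> A_ptw.
pose F := [set ((fun y => '[v, y]) : G -> R^o) | v in A].
have F_lin g : F g -> bounded_fun_norm g /\ linear g.
  move=> [v _ <-]; split; last by move=> t y w; rewrite innerDr innerZr.
  move=> s; exists (`|v| * s) => y ys.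
  by rewrite (le_trans (normr_inner_le _ _))// ler_wpM2l.
have F_ptw : pointwise_bounded F.
  by move=> y; have [C hC] := A_ptw y; exists C => _ [v Av <-]; exact: hC.
have [C FC] := Banach_Steinhauss F_lin F_ptw 1.
exists (Num.max C 0) => v Av; rewrite le_max.
have [->|v0] := eqVneq v 0; first by rewrite normr0 lexx orbT.
have nv : 0 < `|v| by rewrite normr_gt0.
have := FC _ (ex_intro2 _ _ v Av erefl) (`|v|^-1 *: v).
rewrite normrZ normfV normr_id mulVf ?gt_eqF// lexx => /(_ isT).
rewrite innerZr inner_norm expr2 mulKf ?gt_eqF// ger0_norm//.
by move=> ->.
Qed.

Lemma barrier_coneP D y :
  barrier_cone D y <-> exists C : R, forall v, D v -> '[y, v] <= C.
Proof.
split=> [|[C DC]]; last first.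
  apply: (@le_lt_trans _ _ C%:E); last by rewrite ltry.
  by apply: ge_ereal_sup => _ [v Dv <-]; rewrite lee_fin; exact: DC.
rewrite /barrier_cone /=.
have ub v : D v -> ('[y, v]%:E <= support_fun D y)%E.
  by move=> Dv; apply: ereal_sup_ubound; exists v.
case: (support_fun D y) ub => [C| |] ub // _; last first.
  by exists 0 => v /ub; rewrite leeNy_eq.
by exists C => v /ub; rewrite lee_fin.
Qed.

End ClosedSubspace.

(** * Summable errors and quasi-Fejer sequences *)

Section QuasiFejer.
Context {R : realType}.

Lemma summable_norm_series (H : hilbertType R) (u : nat -> H) :
  summable_norm u -> cvgn (series (fun n => `|u n|)).
Proof.
move=> u_sum; apply: nondecreasing_is_cvgn.
  by apply/nondecreasing_seqP => n; rewrite !seriesEnat /= big_nat_recr//= lerDl.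
have u_ge0 n : (0 <= `|u n|%:E)%E by rewrite lee_fin.
have sum_fin : (\sum_(0 <= n <oo) `|u n|%:E)%E \is a fin_num.
  by rewrite ge0_fin_numE//; exact: nneseries_ge0.
exists (fine (\sum_(0 <= n <oo) `|u n|%:E)%E) => _ [n _ <-].
rewrite -lee_fin fineK// seriesEnat /= -sumEFin.
exact: nneseries_lim_ge.
Qed.

(** Subtracting the partial sums of [e] from [u] leaves a nonincreasing sequence that is bounded
    below. *)
Lemma quasi_fejer_cvg (u e : nat -> R) :
  (forall n, 0 <= u n) -> (forall n, u n.+1 <= u n + e n) ->
  (forall n, 0 <= e n) -> cvgn (series e) -> cvgn u.
Proof.
move=> u_ge0 u_le e_ge0 e_cvg.
have e_le n : series e n <= limn (series e).
  apply: nondecreasing_cvgn_le => //.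
  by apply/nondecreasing_seqP => k; rewrite !seriesEnat /= big_nat_recr//= lerDl.
have w_cvg : cvgn (fun n => u n - series e n).
  apply: nonincreasing_is_cvgn.
    apply/nonincreasing_seqP => n.
    by rewrite !seriesEnat /= big_nat_recr//=; have := u_le n; lra.
  by exists (- limn (series e)) => _ [n _ <-]; have := e_le n; have := u_ge0 n; lra.
have -> : u = (fun n => u n - series e n) \+ series e.
  by apply/funext => n /=; rewrite subrK.
exact: is_cvgD.
Qed.

Lemma sqr_cvg0 (T : Type) (F : set_system T) (FF : Filter F) (u : T -> R) :
  u t ^+ 2 @[t --> F] --> 0 -> u @ F --> 0.
Proof.
move=> u2; apply/cvgr0Pnorm_lt => e e0.
move/cvgr0Pnorm_lt: u2 => /(_ _ (exprn_gt0 2 e0)); apply: filterS => t.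
by rewrite normrX ltr_sqr// nnegrE ltW.
Qed.

Lemma norm_dist_cvg (T : Type) (F : set_system T) (FF : Filter F)
    (H : hilbertType R) (u : T -> H) (l : H) :
  `|u t - l| @[t --> F] --> 0 -> u @ F --> l.
Proof.
move=> ul; apply/cvgrPdist_lt => e e0.
move/cvgr0Pnorm_lt: ul => /(_ _ e0); apply: filterS => t.
by rewrite normr_id distrC.
Qed.

Lemma cvg_norm_dist (T : Type) (F : set_system T) (FF : Filter F)
    (H : hilbertType R) (u : T -> H) (l : H) :
  u @ F --> l -> `|u t - l| @[t --> F] --> 0.
Proof.
move=> ul; apply/cvgr0Pnorm_lt => e e0.
move/cvgrPdist_lt: ul => /(_ _ e0); apply: filterS => t.
by rewrite normr_id distrC.
Qed.

End QuasiFejer.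

(** * The dual function and its optimality conditions *)

Section Duality.
Context {R : realType} {H G : hilbertType R}.
Context (f : H -> \bar R) (D : set G) (L : {linear H -> G}) (z : H) (r : G).
Hypotheses (f_proper : proper_efun f) (f_lsc : lower_semicontinuous f).
Hypothesis f_convex : convex_efun f.
Hypotheses (D_neq0 : D !=set0) (D_closed : closed D).
Hypothesis D_convex : convex_set (D : set (convex_lmodType G)).
Hypothesis L_bounded : bounded_operator L.
Implicit Types (v w : G) (x : H).

Definition primal_point v : H := prox f (z - adjoint L v).

Definition residual v : G := L (primal_point v) - r.

Definition dual_fun v : R := conj_env f (z - adjoint L v) + '[v, r].

(* [- residual] is the gradient of [dual_fun], so these are the solutions of
   the variational inequality expressing optimality in the dual problem. *)
Definition kkt v := D v /\ forall w, D w -> '[residual v, w - v] <= 0.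

Lemma dual_objectiveE v : dual_objective f L z r v = (dual_fun v)%:E.
Proof. by rewrite /dual_objective moreau_envelope_conjugateE. Qed.

(** A point of the domain of [f] yields an affine minorant of the dual function; by [dual_funE] the
    minorant given by [primal_point v] is exact at [v]. *)
Lemma dual_fun_ge x (s : R) v : f x = s%:E ->
  '[x, z] - s - 2^-1 * `|x| ^+ 2 - '[L x - r, v] <= dual_fun v.
Proof.
move=> fx; have := conj_env_ge f_proper f_lsc f_convex (z - adjoint L v) fx.
rewrite /dual_fun innerBr -(adjointP L_bounded) innerBl (innerC v r); lra.
Qed.

Lemma dual_funE v : dual_fun v =
  '[primal_point v, z] - fine (f (primal_point v))
  - 2^-1 * `|primal_point v| ^+ 2 - '[residual v, v].
Proof.
rewrite /dual_fun /conj_env -/(primal_point v) innerBr -(adjointP L_bounded).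
by rewrite /residual innerBl (innerC v r); ring.
Qed.

Lemma primal_point_fin v : f (primal_point v) = (fine (f (primal_point v)))%:E.
Proof. exact/esym/fineK/prox_fin_num. Qed.

(** Evaluates at [w] the affine minorant that is exact at [v]. *)
Lemma dual_fun_subgradient v w :
  dual_fun v - '[residual v, w - v] <= dual_fun w.
Proof.
have := dual_fun_ge w (primal_point_fin v).
rewrite -/(residual v) (dual_funE v) (innerBr w v); lra.
Qed.

Lemma residualB v w :
  residual v - residual w = L (primal_point v - primal_point w).
Proof. by rewrite /residual opprB addrA subrK linearB. Qed.

(** This is [prox_firm] carried through the adjoint. The minus sign appears because [residual] is
    the opposite of the gradient. *)
Lemma primal_point_cocoercive v w :
  `|primal_point v - primal_point w| ^+ 2 <= - '[residual v - residual w, v - w].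
Proof.
have := prox_firm f_proper f_lsc f_convex (z - adjoint L v) (z - adjoint L w).
rewrite -/(primal_point v) -/(primal_point w) => /le_trans; apply.
rewrite residualB (adjointP L_bounded) (adjointB L_bounded) -innerNr.
by rewrite [z - _]addrC addrKA opprB [- _ + _]addrC opprK.
Qed.

Lemma residual_dist v w : `|residual v - residual w| <=
  opnorm L * `|primal_point v - primal_point w|.
Proof.
by rewrite residualB; exact: opnorm_le.
Qed.

Lemma primal_point_lipschitz v w :
  `|primal_point v - primal_point w| <= opnorm L * `|v - w|.
Proof.
set d := primal_point v - primal_point w.
have [->|d0] := eqVneq d 0.
  rewrite normr0 mulr_ge0//; apply: le_trans (opnorm_ub L_bounded (x := 0) _).
    exact: normr_ge0.
  by rewrite normr0.
have nd : 0 < `|d| by rewrite normr_gt0.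
rewrite -(ler_pM2l nd) -expr2 (le_trans (primal_point_cocoercive v w))//.
rewrite -innerNr (le_trans (inner_le _ _))// normrN mulrCA mulrA ler_wpM2r//.
exact: residual_dist.
Qed.

Lemma kkt_argmin v : kkt v -> argmin D (dual_objective f L z r) v.
Proof.
move=> [Dv v_le]; split=> // w Dw; rewrite !dual_objectiveE lee_fin.
by apply: le_trans (dual_fun_subgradient v w); have := v_le w Dw; lra.
Qed.

(** The subgradient inequality at u = v + t (w - v) and the minimality of [v] give <residual u|w -
    v> <= 0. Lipschitz continuity replaces u by [v] at a cost of order t. *)
Lemma min_dual_fun_kkt v :
  D v -> (forall w, D w -> dual_fun v <= dual_fun w) -> kkt v.
Proof.
move=> Dv v_min; split=> // w Dw.
apply: (@le0_of_le_scaled _ _ (opnorm L ^+ 2 * `|w - v| ^+ 2)) => t t01.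
have /andP[t0 t1] := t01.
pose u := t *: w + (1 - t) *: v.
have uv : u - v = t *: (w - v).
  by rewrite /u scalerBl scale1r addrAC addrA subrK -scalerBr.
have := dual_fun_subgradient u v; have := v_min u (convex_setP D_convex Dw Dv t01).
rewrite -(opprB u v) uv innerNr innerZr opprK => le1 le2.
have {le1 le2} ru : '[residual u, w - v] <= 0.
  by rewrite -(pmulr_rle0 _ t0); lra.
have vu : `|residual v - residual u| <= opnorm L ^+ 2 * (t * `|w - v|).
  rewrite (le_trans (residual_dist v u))// expr2 -mulrA ler_wpM2l//.
    apply: le_trans (opnorm_ub L_bounded (x := 0) _); first exact: normr_ge0.
    by rewrite normr0.
  rewrite -(gtr0_norm t0) -normrZ -uv (distrC u v).
  exact: primal_point_lipschitz.
have := inner_le (residual v - residual u) (w - v); rewrite innerBl.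
have := ler_wpM2r (normr_ge0 (w - v)) vu.
by rewrite (_ : _ * _ * _ = t * (opnorm L ^+ 2 * `|w - v| ^+ 2)); [lra|ring].
Qed.

Lemma support_fun_kkt v : kkt v -> (support_fun D (residual v) <= '[residual v, v]%:E)%E.
Proof.
move=> [Dv v_le]; apply: ge_ereal_sup => _ [w Dw <-]; rewrite lee_fin.
by have := v_le w Dw; rewrite innerBr; lra.
Qed.

(* The affine minorants of [f] and of the support function given by [v] are
   tight at [p(v)], so the primal objective exceeds its value at [p(v)] by
   |x - p(v)|^2/2 at least. *)
Lemma kkt_primal_point v x :
  kkt v -> argmin setT (primal_objective f D L z r) x -> x = primal_point v.
Proof.
move=> v_kkt [_ /(_ (primal_point v) I)]; rewrite /primal_objective.
have [Dv _] := v_kkt; have [f_noo _] := f_proper.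
have := support_fun_kkt v_kkt; rewrite /residual.
set p := primal_point v => p_supp x_le.
have : (f p + support_fun D (L p - r)%R + (2^-1 * `|p - z| ^+ 2)%:E <=
        f p + '[L p - r, v]%:E + (2^-1 * `|p - z| ^+ 2)%:E)%E.
  by rewrite leeD2r// leeD2l.
move/(le_trans x_le); rewrite (primal_point_fin v) -/p -!EFinD => {}x_le.
have x_supp : ('[L x - r, v]%:E <= support_fun D (L x - r)%R)%E.
  by apply: ereal_sup_ubound; exists v.
have {x_supp}x_le : (f x + '[L x - r, v]%:E + (2^-1 * `|x - z| ^+ 2)%:E <=
  (fine (f p) + '[L p - r, v] + 2^-1 * `|p - z| ^+ 2)%:E)%E.
  by apply: le_trans x_le; rewrite leeD2r// leeD2l.
have := prox_ineq f_proper f_lsc f_convex (z - adjoint L v) x.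
rewrite -/(primal_point v) (primal_point_fin v) -/p.
have := f_noo x; case: (f x) x_le => [s| |] //; rewrite -!EFinD !lee_fin => x_le _.
move=> p_le; apply/eqP; rewrite -subr_eq0 -normr_eq0 -sqrf_eq0.
rewrite eq_le sqr_ge0 andbT.
have := adjointP L_bounded (x - p) v; rewrite linearB => L_xp.
have xz : `|x - z| ^+ 2 = `|x - p| ^+ 2 + 2 * '[x - p, p - z] + `|p - z| ^+ 2.
  by rewrite -normr_sqD addrA subrK.
move: x_le p_le L_xp; rewrite xz !innerE !(innerC z) !(innerC (adjoint L v)).
by rewrite (innerC p x) -!inner_norm; lra.
Qed.

(** * Existence of a dual solution *)

Lemma dom_fin x : dom f x -> exists s : R, f x = s%:E.
Proof.
rewrite /dom /=; have [/(_ x) + _] := f_proper.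
by case: (f x) => [s| |] // _ _; exists s.
Qed.

(* Normals to D lie in its barrier cone. *)
Lemma barrier_cone_orthogonal v w :
  D v -> (forall b, barrier_cone D b -> '[b, w] = 0) -> D (v + w).
Proof.
move=> Dv w_orth.
have [Dd d_le] := projectorP D_neq0 D_closed D_convex (v + w).
set d := projector D (v + w) in Dd d_le.
have n_bar : barrier_cone D (v + w - d).
  apply/barrier_coneP; exists '[v + w - d, d] => u Du.
  by have := d_le u Du; rewrite innerBr; lra.
(* [w] is orthogonal to the normal v + w - d, so it drops from one factor and leaves the variational
   inequality at [v]. *)
have n0 : `|v + w - d| ^+ 2 <= 0.
  rewrite -inner_norm [X in '[_, X]]addrAC innerDr (w_orth _ n_bar) addr0.
  exact: d_le.
suff -> : v + w = d by [].
apply/eqP; rewrite -subr_eq0 -normr_eq0 -sqrf_eq0.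
by rewrite eq_le n0 sqr_ge0.
Qed.

Lemma sub_linear_span (S : set G) : S `<=` linear_span S.
Proof.
move=> y Sy; exists 1%N, (fun=> 1), (fun=> y); split=> //.
by rewrite big_ord1 scale1r.
Qed.

(* Attouch-Brezis: the qualification condition bounds the lower level sets of
   the dual objective in every direction of V, the closed span of
   L(dom f) - bar D - r, while D and the dual objective are invariant under
   translations orthogonal to V. *)
Lemma kkt_exists :
  sri (minkowski_sub (L @` dom f) (barrier_cone D)) r -> exists v, kkt v.
Proof.
set S := minkowski_sub _ _; set T := translate S r.
move=> [[_ [a0 a0_dom <-]] [b0 b0_bar r_eq] T_cone].
pose V := closure (linear_span T).
have V_sub : is_subspace V by apply: closure_subspace; exact: linear_span_subspace.
have V_closed : closed V by exact: closed_closure.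
have V_neq0 : V !=set0 by exists 0; case: V_sub.
have [V0 VP] := V_sub.
have TV : T `<=` V by move=> y /sub_linear_span; exact: subset_closure.
have [C0 bC0] := (barrier_coneP _ _).1 b0_bar.
(* The barrier cone is stable under sums, so - b = L a0 - (b0 + b) - r belongs to [T]. *)
have barV b : barrier_cone D b -> V b.
  move=> b_bar; rewrite -(opprK b); apply: (subspaceN V_sub); apply: TV.
  have [C bC] := (barrier_coneP _ _).1 b_bar.
  exists (L a0 - (b0 + b)); last by rewrite (opprD b0) addrA r_eq addrAC subrr add0r.
  exists (L a0); first by exists a0.
  exists (b0 + b) => //; apply/barrier_coneP; exists (C0 + C) => v Dv.
  by rewrite innerDl lerD// ?bC0 ?bC.
have domV x : dom f x -> V (L x - r).
  move=> x_dom; rewrite -(subrK b0 (L x - r)) -[_ - b0]scale1r.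
  apply: VP; last exact: barV.
  apply: TV; exists (L x - b0); last by rewrite addrAC.
  by exists (L x); [exists x|exists b0].
pose P := projector V.
have VPv v : V (P v).
  by have [] := projectorP V_neq0 V_closed (subspace_convex V_sub) v.
have PV v y : V y -> '[v - P v, y] = 0 by exact: projector_orthogonal.
have DP v : D v -> D (P v).
  move=> Dv; rewrite -(subrKC v (P v)); apply: barrier_cone_orthogonal => //.
  by move=> b /barV Vb; rewrite innerC -opprB innerNl PV// oppr0.
(* The minorant exact at [P v] has its slope in [V], so it takes the same value at [v] and at
   [P v]. *)
have dual_P v : dual_fun (P v) <= dual_fun v.
  have fP := primal_point_fin (P v); rewrite (dual_funE (P v)).
  apply: le_trans (dual_fun_ge v fP); rewrite -/(residual (P v)).
  have V_res : V (residual (P v)) by apply: domV; rewrite /dom /= fP ltry.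
  by have := PV v _ V_res; rewrite innerBl !(innerC _ (residual _)); lra.
(* The cone equality in [sri] enters here: [y] is a positive multiple of L a - b - r. On the level
   set [dual_fun_ge] bounds <L a - r|v> from below, while <b|v> is bounded above on [D]. *)
have low M y : V y ->
    exists C : R, forall v, D v /\ dual_fun v <= M -> C <= '[v, y].
  rewrite /V -T_cone => -[l l0 [_ [_ [_ [a a_dom <-]] [b b_bar <-]] <-] ->].
  have [s fa] := dom_fin a_dom; have [C bC] := (barrier_coneP _ _).1 b_bar.
  exists (l * ('[a, z] - s - 2^-1 * `|a| ^+ 2 - M - C)) => v [Dv vM].
  rewrite innerZr ler_pM2l// (innerC v) [_ - r]addrAC (innerBl _ b).
  have := dual_fun_ge v fa; have := bC v Dv; lra.
have bnd M : exists C : R, forall v, [/\ D v, V v & dual_fun v <= M] -> `|v| <= C.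
  apply: weakly_bounded_bounded => y.
  have [C1 hC1] := low M _ (VPv y).
  have [C2 hC2] := low M _ (subspaceN V_sub (VPv y)).
  exists (Num.max (- C1) (- C2)) => v [Dv Vv vM].
  have -> : '[v, y] = '[v, P y].
    by apply/eqP; rewrite -subr_eq0 -innerBr innerC PV.
  have := hC1 v (conj Dv vM); have := hC2 v (conj Dv vM); rewrite innerNr => h2 h1.
  by rewrite ler_norml lerNl !le_max; apply/andP; split; apply/orP;
    [left|right]; lra.
pose E := [set dual_fun v | v in D].
have E_inf : has_inf E.
  split; first by have [v Dv] := D_neq0; exists (dual_fun v), v.
  have [s fa] := dom_fin a0_dom.
  exists ('[a0, z] - s - 2^-1 * `|a0| ^+ 2 - C0) => _ [v Dv <-].
  apply: le_trans (dual_fun_ge v fa); have := bC0 v Dv.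
  by rewrite -r_eq opprB addrCA subrr addr0; lra.
(* Projecting a minimizing sequence onto [V] keeps it in [D] without raising the dual values, and
   makes it bounded by [bnd]. *)
have h n : exists v, [/\ D v, V v & dual_fun v <= inf E + n.+1%:R^-1].
  have /inf_adherent/(_ E_inf)[_ [v Dv <-] /ltW vn] : 0 < n.+1%:R^-1 :> R by [].
  by exists (P v); split; [exact: DP|exact: VPv|exact: le_trans vn].
have {h}[u u_min] := choice h.
have [C hC] := bnd (inf E + 1).
have uC n : `|u n| <= C.
  apply: hC; have [Du Vu un] := u_min n; split=> //; apply: le_trans un _.
  by rewrite lerD2l invf_le1// ler1n.
have [U [UU sU]] := @ultraFilterLemma nat \oo _.
have [v uv] := weak_ultralimit UU uC.
have Dv : D v.
  apply: (convex_weak_closed _ D_closed D_convex _ uv).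
  by apply: filterE => n; case: (u_min n).
exists v; apply: min_dual_fun_kkt => // w Dw.
apply: (@le_trans _ _ (inf E)); last by apply: ge_inf; [case: E_inf|exists w].
have lim1 : inf E + n.+1%:R^-1 @[n --> U] --> inf E + 0.
  apply: cvgD; first exact: cvg_cst.
  by apply: cvg_trans (@cvg_harmonic R); exact: cvg_app.
(* Weak lower semicontinuity at [v]: the subgradient at [v] is a fixed vector, so its pairing with u
   n - v tends to 0. *)
have lim2 : dual_fun v - '[u n - v, residual v] @[n --> U] --> dual_fun v - 0.
  apply: cvgB; first exact: cvg_cst.
  rewrite -(subrr '[v, residual v]); under eq_fun do rewrite innerBl.
  by apply: cvgB => //; exact: cvg_cst.
have := ler_cvg_to lim2 lim1; rewrite subr0 addr0; apply.
apply: filterE => n; have [_ _] := u_min n; apply: le_trans.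
by rewrite innerC; exact: dual_fun_subgradient.
Qed.

(** * Convergence of the inexact forward-backward iteration *)

Hypothesis L_gt0 : 0 < opnorm L.

Definition forward_backward (gamma : R) v : G :=
  projector D (v + gamma *: residual v).

(** Combines the inequality of the projection tested at [q], the optimality of [q] tested at the new
    point, and cocoercivity. The last square is kept because it later forces v_n - s_n to 0. *)
Lemma forward_backward_descent eps gamma v q :
  0 < eps -> eps <= gamma <= 2 * opnorm L ^- 2 - eps -> kkt q ->
  `|forward_backward gamma v - q| ^+ 2
    + (eps * opnorm L) ^+ 2 * `|primal_point v - primal_point q| ^+ 2
    + `|v - forward_backward gamma v + gamma *: (residual v - residual q)| ^+ 2
  <= `|v - q| ^+ 2.
Proof.
move=> e0 /andP[ge gle] [Dq q_le].
have [Ds s_le] := projectorP D_neq0 D_closed D_convex (v + gamma *: residual v).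
rewrite /forward_backward; set s := projector D _ in Ds s_le *.
have g0 : 0 < gamma by exact: lt_le_trans ge.
have := q_le s Ds; have := s_le q Dq.
set rho := residual v; set rq := residual q => sq qs.
have coco := primal_point_cocoercive v q; rewrite -/rho -/rq in coco.
have dist : `|rho - rq| ^+ 2 <= opnorm L ^+ 2 * `|primal_point v - primal_point q| ^+ 2.
  by rewrite -exprMn ler_sqr ?nnegrE ?mulr_ge0 ?(ltW L_gt0)//; exact: residual_dist.
set d := `|primal_point v - primal_point q| ^+ 2 in coco dist *.
have d0 : 0 <= d by exact: sqr_ge0.
(* With l = |L|^2, the bounds on gamma give gamma >= eps and 2 - gamma l >= eps l. *)
have step : (eps * opnorm L) ^+ 2 * d <= (2 * gamma - gamma ^+ 2 * opnorm L ^+ 2) * d.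
  rewrite ler_wpM2r// exprMn.
  have l2 : 0 < opnorm L ^+ 2 by rewrite exprn_gt0.
  have : eps * opnorm L ^+ 2 <= 2 - gamma * opnorm L ^+ 2.
    have := ler_wpM2r (ltW l2) gle; rewrite mulrBl -mulrA mulVf ?gt_eqF//; lra.
  move: (opnorm L ^+ 2) l2 => l l2 hl.
  have -> : eps ^+ 2 * l = eps * (eps * l) by ring.
  have -> : 2 * gamma - gamma ^+ 2 * l = gamma * (2 - gamma * l) by ring.
  by apply: ler_pM => //; rewrite ?mulr_ge0 ?ltW.
have vq : `|v - q| ^+ 2 = `|v - s| ^+ 2 + 2 * '[v - s, s - q] + `|s - q| ^+ 2.
  by rewrite -normr_sqD addrA subrK.
have vs : '[v - s, s - q] >= - (gamma * '[rho - rq, s - q]).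
  have := mulr_ge0_le0 (ltW g0) qs.
  move: sq; rewrite -(opprB s q) [X in '[X, _]]addrAC innerNr (innerDl (v - s)).
  by rewrite innerZl (innerBl rho rq); lra.
have dvq : '[rho - rq, v - q] = '[rho - rq, v - s] + '[rho - rq, s - q].
  by rewrite -innerDr addrA subrK.
rewrite vq (normr_sqD (v - s)) innerZr normrZ exprMn (gtr0_norm g0).
rewrite (innerC (v - s) (rho - rq)).
have := ler_wpM2l (sqr_ge0 gamma) dist; have := ler_wpM2l (ltW g0) coco.
by rewrite dvq; lra.
Qed.

Context (eps : R) (gamma lambda : nat -> R) (a v_ : nat -> G) (b x_ : nat -> H).
Hypothesis eps_gt0 : 0 < eps.
Hypothesis gamma_itv : forall n, eps <= gamma n <= 2 * opnorm L ^- 2 - eps.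
Hypothesis lambda_itv : forall n, eps <= lambda n <= 1.
Hypotheses (a_summable : summable_norm a) (b_summable : summable_norm b).
Hypothesis x_def : forall n, x_ n = primal_point (v_ n) + b n.
Hypothesis v_rec : forall n, v_ n.+1 = v_ n + lambda n *:
  (projector D (v_ n + gamma n *: (L (x_ n) - r)) + a n - v_ n).

Let s n := forward_backward (gamma n) (v_ n).

(** Bounds the effect of both errors on one step: the projection is nonexpansive, and gamma n |L| <=
    2 / |L| gives the factor of |b n|. *)
Let err n := `|a n| + 2 / opnorm L * `|b n|.

Let err_ge0 n : 0 <= err n.
Proof. by rewrite addr_ge0// mulr_ge0// divr_ge0// ltW. Qed.

Let err_cvg : cvgn (series err).
Proof.
have -> : series err = series (fun n => `|a n|) \+
    (fun n => 2 / opnorm L * series (fun n => `|b n|) n).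
  apply/funext => n; rewrite !seriesEnat /= big_split /=.
  by rewrite -mulr_sumr.
by apply: is_cvgD; [|apply: is_cvgMr]; exact: summable_norm_series.
Qed.

Let gamma_gt0 n : 0 < gamma n.
Proof. by have /andP[ge _] := gamma_itv n; exact: lt_le_trans ge. Qed.

Let gamma_le n : gamma n * opnorm L <= 2 / opnorm L.
Proof.
rewrite -(ler_pM2r L_gt0) -mulrA -expr2 divfK ?gt_eqF//.
have l2 : 0 < opnorm L ^+ 2 by rewrite exprn_gt0.
have /andP[_ gle] := gamma_itv n; rewrite -ler_pdivlMr// (le_trans gle)//.
by rewrite gerBl ltW.
Qed.

(** The relaxed step without errors, with [v_ n.+1] within [err n] of it. *)
Let y n := v_ n + lambda n *: (s n - v_ n).

Let v_y_dist n : `|v_ n.+1 - y n| <= err n.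
Proof.
have -> : v_ n.+1 - y n = lambda n *:
    (projector D (v_ n + gamma n *: (L (x_ n) - r)) - s n + a n).
  rewrite v_rec /y opprD addrACA subrr add0r -scalerBr; congr (_ *: _).
  by rewrite opprB addrA subrK addrAC.
have /andP[le_eps le1] := lambda_itv n.
rewrite normrZ ger0_norm; last by rewrite (le_trans (ltW eps_gt0)).
rewrite (le_trans (ler_piMl _ le1))// (le_trans (ler_normD _ _))// addrC lerD2l.
rewrite (le_trans (projector_nonexpansive D_neq0 D_closed D_convex _ _))//.
rewrite opprD addrACA subrr add0r -scalerBr /residual opprB addrA subrK -linearB.
rewrite x_def addrAC subrr add0r.
rewrite normrZ gtr0_norm//.
rewrite (le_trans (ler_wpM2l (ltW (gamma_gt0 n)) (opnorm_le L_bounded _)))//.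
by rewrite mulrA ler_wpM2r ?gamma_le.
Qed.

Let W q n := (eps * opnorm L) ^+ 2 * `|primal_point (v_ n) - primal_point q| ^+ 2
  + `|v_ n - s n + gamma n *: (residual (v_ n) - residual q)| ^+ 2.

Let W_ge0 q n : 0 <= W q n.
Proof. by apply: addr_ge0; [apply: mulr_ge0|]; exact: sqr_ge0. Qed.

(** Convexity of the squared norm transfers the descent to the relaxed point, and lambda n >= eps
    leaves at least the share eps of [W]. *)
Let y_descent q n : kkt q -> `|y n - q| ^+ 2 + eps * W q n <= `|v_ n - q| ^+ 2.
Proof.
move=> q_kkt.
have := forward_backward_descent (v_ n) eps_gt0 (gamma_itv n) q_kkt.
rewrite -/(s n) -addrA -/(W q n) => h.
have /andP[le_eps le1] := lambda_itv n.
have -> : y n - q = lambda n *: (s n - q) + (1 - lambda n) *: (v_ n - q).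
  rewrite scalerBl scale1r addrCA -scalerBr /y addrAC; congr (_ + _ *: _).
  by rewrite opprB addrA subrK.
rewrite normr_sq_convex.
have := W_ge0 q n.
have : 0 <= lambda n * (1 - lambda n) * `|s n - q - (v_ n - q)| ^+ 2.
  apply: mulr_ge0; last exact: sqr_ge0.
  by rewrite mulr_ge0 ?subr_ge0// (le_trans (ltW eps_gt0)).
have := ler_wpM2r (W_ge0 q n) le_eps.
have := ler_wpM2l (le_trans (ltW eps_gt0) le_eps) h; lra.
Qed.

Let v_dist_cvg q : kkt q -> cvgn (fun n => `|v_ n - q|).
Proof.
move=> q_kkt; apply: (quasi_fejer_cvg _ _ err_ge0 err_cvg) => n //.
rewrite -(subrKA (y n) (v_ n.+1) (- q)) (le_trans (ler_normD _ _))// addrC.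
rewrite lerD ?v_y_dist// -ler_sqr ?nnegrE//.
by have := y_descent n q_kkt; have := mulr_ge0 (ltW eps_gt0) (W_ge0 q n); lra.
Qed.

(** eps W is at most u_n^2 - u_{n+1}^2 plus an error term, where u_n = |v_n - q|. As u_n converges,
    this bound tends to 0. *)
Let W_cvg0 q : kkt q -> W q n @[n --> \oo] --> 0.
Proof.
move=> q_kkt; pose u n := `|v_ n - q|.
have /cvg_ex[/= c uc] := v_dist_cvg q_kkt.
have uc1 : u n.+1 @[n --> \oo] --> c by rewrite cvg_shiftS.
have err0 : err n @[n --> \oo] --> 0 by exact: cvg_series_cvg_0.
pose ub n := eps^-1 * (u n ^+ 2 - u n.+1 ^+ 2 + 2 * (u n.+1 * err n)).
have ub0 : ub n @[n --> \oo] --> 0.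
  rewrite [X in _ --> X](_ : 0 = eps^-1 * (c ^+ 2 - c ^+ 2 + 2 * (c * 0))); last by ring.
  apply: cvgMr; apply: cvgD; last by apply: cvgMr; apply: cvgM.
  by apply: cvgB; rewrite expr2; under eq_fun do rewrite expr2; exact: cvgM.
apply: (squeeze_cvgr _ (cvg_cst 0) ub0); apply: filterE => n.
rewrite W_ge0 /= /ub -ler_pdivrMl ?invr_gt0// invrK.
have := y_descent n q_kkt; rewrite -/(u n).
have : u n.+1 <= `|y n - q| + err n.
  rewrite /u -(subrKA (y n) (v_ n.+1) (- q)) (le_trans (ler_normD _ _))// addrC.
  by rewrite lerD2l v_y_dist.
have := err_ge0 n; have : 0 <= u n.+1 by exact: normr_ge0.
have := normr_ge0 (y n - q).
move: (W q n) (u n) (u n.+1) (err n) `|y n - q| => w un u1 e yq yq0 u10 e0 h1 h2.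
suff : u1 ^+ 2 - 2 * (u1 * e) <= yq ^+ 2 by lra.
(* Squaring u1 - e <= yq requires u1 >= e; otherwise u1^2 - 2 u1 e is already nonpositive. *)
have [eu|ue] := leP e u1; last by nra.
have : (u1 - e) ^+ 2 <= yq ^+ 2 by rewrite ler_sqr ?nnegrE ?subr_ge0//; lra.
by have := sqr_ge0 e; rewrite sqrrB; lra.
Qed.

Let primal_point_cvg q : kkt q ->
  primal_point (v_ n) @[n --> \oo] --> primal_point q.
Proof.
move=> q_kkt; apply: norm_dist_cvg; apply: sqr_cvg0.
pose k := (eps * opnorm L) ^+ 2.
have k0 : 0 < k by rewrite exprn_gt0// mulr_gt0.
have Wk : k^-1 * W q n @[n --> \oo] --> 0.
  by rewrite -[0](mulr0 k^-1); apply: cvgMr; exact: W_cvg0.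
apply: (squeeze_cvgr _ (cvg_cst 0) Wk); apply: filterE => n.
by rewrite sqr_ge0 /= -ler_pdivrMl ?invr_gt0// invrK lerDl sqr_ge0.
Qed.

Let residual_cvg q : kkt q -> residual (v_ n) @[n --> \oo] --> residual q.
Proof.
move=> q_kkt; apply: norm_dist_cvg.
have P0 : opnorm L * `|primal_point (v_ n) - primal_point q| @[n --> \oo] --> 0.
  rewrite -[0](mulr0 (opnorm L)); apply: cvgMr; apply: cvg_norm_dist.
  exact: primal_point_cvg.
apply: (squeeze_cvgr _ (cvg_cst 0) P0); apply: filterE => n.
by rewrite normr_ge0 residual_dist.
Qed.

Let s_dist_cvg0 q : kkt q -> `|v_ n - s n| @[n --> \oo] --> 0.
Proof.
move=> q_kkt.
pose d n := v_ n - s n + gamma n *: (residual (v_ n) - residual q).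
have d0 : `|d n| @[n --> \oo] --> 0.
  apply: sqr_cvg0; apply: (squeeze_cvgr _ (cvg_cst 0) (W_cvg0 q_kkt)).
  apply: filterE => n; rewrite sqr_ge0 /= lerDr.
  by apply: mulr_ge0; exact: sqr_ge0.
have P0 : 2 / opnorm L * `|primal_point (v_ n) - primal_point q| @[n --> \oo] --> 0.
  rewrite -[0](mulr0 (2 / opnorm L)); apply: cvgMr; apply: cvg_norm_dist.
  exact: primal_point_cvg.
have dP0 : `|d n| + 2 / opnorm L * `|primal_point (v_ n) - primal_point q|
    @[n --> \oo] --> 0 by rewrite -[0]addr0; exact: cvgD.
apply: (squeeze_cvgr _ (cvg_cst 0) dP0); apply: filterE => n; rewrite normr_ge0 /=.
rewrite -[v_ n - s n](addrK (gamma n *: (residual (v_ n) - residual q))) -/(d n).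
rewrite (le_trans (ler_normB _ _))// lerD2l normrZ gtr0_norm//.
rewrite (le_trans (ler_wpM2l (ltW (gamma_gt0 n)) (residual_dist _ _)))//.
by rewrite mulrA ler_wpM2r ?gamma_le.
Qed.

Let v_bounded q : kkt q -> exists M : R, forall n, `|v_ n| <= M.
Proof.
move=> /v_dist_cvg /cvg_seq_bounded [M [_ hM]]; exists (M + 1 + `|q|) => n.
rewrite -(subrK q (v_ n)) (le_trans (ler_normD _ _))// lerD2r.
have M1 : M < M + 1 by rewrite ltrDl.
by have := hM _ M1 n I; rewrite /= normr_id.
Qed.

(** v_n and s_n share their weak limit, which lies in [D]. Residuals converge strongly, so the
    projection inequality for s_n passes to the limit. *)
Let weak_cluster_kkt q (U : set_system nat) v : kkt q -> UltraFilter U ->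
  \oo `<=` U -> (forall w, '[v_ n, w] @[n --> U] --> '[v, w]) -> kkt v.
Proof.
move=> q_kkt UU sU v_weak; have [M vM] := v_bounded q_kkt.
have toU (V : topologicalType) (u : nat -> V) (l : V) :
  u @ \oo --> l -> u @ U --> l.
  by move=> ul; apply: cvg_trans ul; exact: cvg_app.
have vs0 : s n - v_ n @[n --> U] --> (0 : G).
  apply: toU; apply: norm_dist_cvg.
  have := s_dist_cvg0 q_kkt.
  by under [in X in _ -> X]eq_fun do rewrite subr0 distrC.
have s_weak w : '[s n, w] @[n --> U] --> '[v, w].
  rewrite -['[v, w]]add0r -(inner0l w).
  have -> : (fun n => '[s n, w]) = (fun n => '[s n - v_ n, w] + '[v_ n, w]).
    by apply/funext => n; rewrite -innerDl subrK.
  by apply: cvgD => //; exact: cvg_innerl.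
have sP n := projectorP D_neq0 D_closed D_convex (v_ n + gamma n *: residual (v_ n)).
have Dv : D v.
  apply: (convex_weak_closed _ D_closed D_convex _ s_weak).
  by apply: filterE => n; have [] := sP n.
(* In the cocoercivity inequality between v_n and v, a strongly convergent factor meets a weakly
   null one, so p(v_n) tends to p(v) as well as to p(q). *)
have res_eq : residual v = residual q.
  have vv_weak w : '[v_ n - v, w] @[n --> U] --> '[0, w].
    rewrite inner0l -(subrr '[v, w]); under eq_fun do rewrite innerBl.
    by apply: cvgB => //; exact: cvg_cst.
  have vvM n : `|v_ n - v| <= M + `|v|.
    by rewrite (le_trans (ler_normB _ _))// lerD2r.
  have res_v : residual (v_ n) - residual v @[n --> U] --> residual q - residual v.
    by apply: cvgB; [exact: (toU _ _ _ (residual_cvg q_kkt))|exact: cvg_cst].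
  have coco0 : - '[residual (v_ n) - residual v, v_ n - v] @[n --> U] --> (0 : R).
    rewrite -[0]oppr0 -(inner0r (residual q - residual v)); apply: cvgN.
    exact: (cvg_inner_weak _ vvM).
  have P_v : primal_point (v_ n) @[n --> U] --> primal_point v.
    apply: norm_dist_cvg; apply: sqr_cvg0.
    apply: (squeeze_cvgr _ (cvg_cst 0) coco0); apply: filterE => n.
    by rewrite sqr_ge0 primal_point_cocoercive.
  have P_q : primal_point (v_ n) @[n --> U] --> primal_point q.
    exact: (toU _ _ _ (primal_point_cvg q_kkt)).
  by rewrite /residual (cvg_unique _ P_v P_q).
split=> // w Dw; rewrite res_eq.
have sM : exists C : R, forall n, `|w - s n| <= C.
  have /cvg_seq_bounded [C [_ hC]] : cvgn (fun n => `|v_ n - s n|).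
    by apply/cvg_ex; exists 0; exact: s_dist_cvg0 q_kkt.
  exists (`|w| + (M + (C + 1))) => n.
  have C1 : C < C + 1 by rewrite ltrDl.
  have := hC _ C1 n I; rewrite /= normr_id => vsC.
  rewrite (le_trans (ler_normB _ _))// lerD2l -[s n](subKr (v_ n)).
  by rewrite (le_trans (ler_normB _ _))// lerD.
have [C sC] := sM.
have ws_weak u : '[w - s n, u] @[n --> U] --> '[w - v, u].
  rewrite innerBl; under eq_fun do rewrite innerBl.
  by apply: cvgB => //; exact: cvg_cst.
have lim : '[residual (v_ n), w - s n] @[n --> U] --> '[residual q, w - v].
  by apply: (cvg_inner_weak _ sC) => //; exact: (toU _ _ _ (residual_cvg q_kkt)).
have bound0 : eps^-1 * (`|v_ n - s n| * C) @[n --> U] --> (0 : R).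
  rewrite -[0](mulr0 eps^-1) -[X in _ * X](mul0r C).
  by apply: cvgMr; apply: cvgMl; exact: (toU _ _ _ (s_dist_cvg0 q_kkt)).
apply: (ler_cvg_to lim bound0); apply: filterE => n.
have [_ /(_ w Dw)] := sP n; rewrite -/(forward_backward _ _) -/(s n).
rewrite [X in '[X, _]]addrAC innerDl innerZl => vi.
rewrite -ler_pdivrMl ?invr_gt0// invrK.
have le_vs : gamma n * '[residual (v_ n), w - s n] <= `|v_ n - s n| * C.
  have := inner_le (- (v_ n - s n)) (w - s n); rewrite normrN innerNl.
  have := ler_wpM2l (normr_ge0 (v_ n - s n)) (sC n); lra.
have C0 : 0 <= `|v_ n - s n| * C.
  by rewrite mulr_ge0// (le_trans (normr_ge0 _) (sC n)).
(* [gamma n] may vary, so it is replaced by its lower bound [eps], which is legitimate only for a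
   positive inner product. *)
have [neg|pos] := leP '[residual (v_ n), w - s n] 0.
  by rewrite (le_trans _ C0)// mulr_ge0_le0// ltW.
apply: le_trans le_vs; apply: ler_wpM2r; first exact: ltW.
by have /andP[] := gamma_itv n.
Qed.

(* Opial: along two ultrafilters with weak limits v and v', the real sequence
   <v_n | v - v'> has the same limit, because |v_n - v| and |v_n - v'| both
   converge. *)
Let weak_cluster_unique (U U' : set_system nat) v v' :
  ProperFilter U -> ProperFilter U' -> \oo `<=` U -> \oo `<=` U' ->
  kkt v -> kkt v' -> (forall w, '[v_ n, w] @[n --> U] --> '[v, w]) ->
  (forall w, '[v_ n, w] @[n --> U'] --> '[v', w]) -> v = v'.
Proof.
move=> UP UP' sU sU' v_kkt v'_kkt Uv Uv'.
have /cvg_ex[/= c vc] := v_dist_cvg v_kkt.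
have /cvg_ex[/= c' vc'] := v_dist_cvg v'_kkt.
pose g n := 2^-1 * (`|v_ n - v'| * `|v_ n - v'| - `|v_ n - v| * `|v_ n - v|
                    + (`|v| ^+ 2 - `|v'| ^+ 2)).
have gE n : '[v_ n, v - v'] = g n.
  by rewrite /g -!expr2 !normr_sqB innerBr; field.
pose l := 2^-1 * (c' * c' - c * c + (`|v| ^+ 2 - `|v'| ^+ 2)).
have gl : '[v_ n, v - v'] @[n --> \oo] --> l.
  under eq_fun do rewrite gE; apply: cvgMr; apply: cvgD; last exact: cvg_cst.
  by apply: cvgB; exact: cvgM.
have gU : '[v_ n, v - v'] @[n --> U] --> l.
  by apply: cvg_trans gl; exact: cvg_app.
have gU' : '[v_ n, v - v'] @[n --> U'] --> l.
  by apply: cvg_trans gl; exact: cvg_app.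
have h : l = '[v, v - v'] by exact: (cvg_unique _ gU (Uv _)).
have h' : l = '[v', v - v'] by exact: (cvg_unique _ gU' (Uv' _)).
apply/eqP; rewrite -subr_eq0 -normr_eq0 -sqrf_eq0 -inner_norm innerBl.
by rewrite -h -h' subrr.
Qed.

(** The weak limit along one ultrafilter is a dual solution; by uniqueness every other ultrafilter
    gives the same limit, so [cvg_ultra] applies to the whole sequence. *)
Lemma dual_iteration_cvg : (exists q, kkt q) ->
  exists v, [/\ kkt v, weak_cvg v_ v & x_ n @[n --> \oo] --> primal_point v].
Proof.
move=> [q q_kkt]; have [M vM] := v_bounded q_kkt.
have [U [UU sU]] := @ultraFilterLemma nat \oo _.
have [v Uv] := weak_ultralimit UU vM.
have v_kkt := weak_cluster_kkt q_kkt UU sU Uv.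
exists v; split=> //.
  move=> w; apply: cvg_ultra => U' UU' sU'.
  have [v' Uv'] := weak_ultralimit UU' vM.
  have v'_kkt := weak_cluster_kkt q_kkt UU' sU' Uv'.
  by rewrite (weak_cluster_unique _ _ sU sU' v_kkt v'_kkt Uv Uv').
have b0 : b n @[n --> \oo] --> 0.
  apply: norm_dist_cvg; under eq_fun do rewrite subr0.
  exact/cvg_series_cvg_0/summable_norm_series.
rewrite -[primal_point v]addr0; under eq_fun do rewrite x_def.
by apply: cvgD => //; exact: primal_point_cvg.
Qed.

End Duality.

Theorem proposition4p13 (R : realType) (H G : hilbertType R)
    (z : H) (r : G) (f : H -> \bar R) (D : set G) (L : {linear H -> G})
    (f_proper : proper_efun f)
    (f_lsc : lower_semicontinuous f)
    (f_convex : convex_efun f)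
    (D_neq0 : D !=set0)
    (D_closed : closed D)
    (D_convex : convex_set (D : set (convex_lmodType G)))
    (L_bounded : bounded_operator L)
    (L_neq0 : exists u : H, L u != 0)
    (r_sri : sri (minkowski_sub (L @` dom f) (barrier_cone D)) r)
    (x : H)
    (x_sol : argmin setT (primal_objective f D L z r) x)
    (a : nat -> G) (a_summable : summable_norm a)
    (b : nat -> H) (b_summable : summable_norm b)
    (eps : R)
    (eps_itv : 0 < eps < Num.min 1 (opnorm L ^- 2))
    (gamma : nat -> R)
    (gamma_itv : forall n, eps <= gamma n <= 2 * opnorm L ^- 2 - eps)
    (lambda : nat -> R)
    (lambda_itv : forall n, eps <= lambda n <= 1)
    (v0 : G) (v_ : nat -> G) (x_ : nat -> H)
    (v_0 : v_ 0%N = v0)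
    (x_def : forall n, x_ n = prox f (z - adjoint L (v_ n)) + b n)
    (v_rec : forall n, v_ n.+1 = v_ n + lambda n *:
       (projector D (v_ n + gamma n *: (L (x_ n) - r)) + a n - v_ n)) :
  (exists v : G, [/\ argmin D (dual_objective f L z r) v,
                     weak_cvg v_ v
                   & x = prox f (z - adjoint L v)])
  /\ x_ n @[n --> \oo] --> x.
Proof.
have eps_gt0 : 0 < eps by case/andP: eps_itv.
have L_gt0 := opnorm_gt0 L_bounded L_neq0.
have q_kkt := kkt_exists z f_proper f_lsc f_convex D_neq0 D_closed D_convex
  L_bounded r_sri.
have [v [v_kkt v_weak x_cvg]] := dual_iteration_cvg f_proper f_lsc f_convex
  D_neq0 D_closed D_convex L_bounded L_gt0 eps_gt0 gamma_itv lambda_itv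
  a_summable b_summable x_def v_rec q_kkt.
have x_eq := kkt_primal_point f_proper f_lsc f_convex L_bounded v_kkt x_sol.
split; last by rewrite x_eq.
by exists v; split=> //; exact: kkt_argmin.
Qed.
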